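(* Let $(b,c)$ be a connected transient graph over $X$. Then the following assertions are equivalent. (ii.a) $Gc(x)=1$ for some (equivalently, all) $x\in X$, i.e., $1\in\mathcal{P}$. (ii.b) For some (equivalently, all) exhaustion(s) $(K_n)$ of $X$ it holds that for some (equivalently, all) $x\in X$ $$\lim_{n\to\infty}(G_{K_n}d_{K_n})(x)=0.$$ (ii.c) $\mathbb{P}_x(\tau<\infty)=1$ for some (equivalently, all) $x\in X$.
   Context: Let $X$ be a countable set. A graph $(b,c)$ over $X$ consists of a symmetric function $b:X\times X\to[0,\infty)$ with $b(x,x)=0$ and $\sum_{y\in X}b(x,y)<\infty$ for all $x\in X$, and a function $c:X\to[0,\infty)$ (the killing term). The graph is connected if for all $x,y\in X$ there are $x=y_1,\dots,y_{n+1}=y$ with $b(y_i,y_{i+1})>0$ for $1\le i\le n$. Let $\mathcal{F}=\{f:X\to\mathbb{R}\mid \sum_y b(x,y)|f(y)|<\infty \text{ for all }x\}$ and, for $f\in\mathcal{F}$, $\mathcal{L}f(x)=\sum_y b(x,y)(f(x)-f(y))+c(x)f(x)$. Let $\mathcal{Q}(f)=\frac12\sum_{x,y}b(x,y)(f(x)-f(y))^2+\sum_x c(x)f(x)^2$, $\mathcal{D}=\{f:X\to\mathbb{R}\mid\mathcal{Q}(f)<\infty\}$, and let $\mathcal{D}_0$ be the closure of the finitely supported functions in $\mathcal{D}$ with respect to $\|f\|_o=\sqrt{\mathcal{Q}(f)+|f(o)|^2}$ for a fixed $o\in X$. The connected graph $(b,c)$ is transient if for every $y\in X$ there is a unique $G_y\in\mathcal{D}_0$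 with $\mathcal{L}G_y=1_{\{y\}}$. The Green function is $G(x,y)=G_y(x)$, and $Gk(x)=\sum_yG(x,y)k(y)$ for $k\ge0$ (with values in $[0,\infty]$) or for $k\in\mathcal{G}=\{k:X\to\mathbb{R}\mid\sum_yG(x,y)|k(y)|<\infty\text{ for all }x\}$. The set of potentials is $\mathcal{P}=\{u\in\mathcal{F}\mid u=Gk\text{ for some }k\in\mathcal{G}\}$. For finite $K\subseteq X$ let $d_K(x)=\sum_{y\in X\setminus K}b(x,y)$ for $x\in K$, and let $L_K$ be the operator on functions on $K$ given by $L_Kf(x)=\sum_{y\in K}b(x,y)(f(x)-f(y))+(c(x)+d_K(x))f(x)$; it is injective and $G_K=(L_K)^{-1}$. An exhaustion of $X$ is a sequence $(K_n)$ of finite subsets with $K_n\subseteq K_{n+1}$ and $\bigcup_nK_n=X$; $(G_{K_n}d_{K_n})(x)$ is considered for $n$ large enough that $x\in K_n$. The random walk $(Y_n)_{n\ge0}$ associated with $(b,c)$ has transition probabilities $p(x,y)=b(x,y)/\deg(x)$ for $x,y\in X$, where $\deg(x)=\sum_yb(x,y)+c(x)$; from $x$ it leaves $X$ (moves to a cemetery state outside $X$, where it stays) with probability $c(x)/\deg(x)$. $\mathbb{P}_x$ is the law of the walk started at $x$, and $\tau=\inf\{n\ge0\mid Y_n\notin X\}$. *)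

(* Defs.v *)
From HB Require Import structures.
From mathcomp Require Export all_boot all_order all_algebra finmap.
From mathcomp Require Export all_classical all_reals all_analysis.

Set Implicit Arguments.
Unset Strict Implicit.
Unset Printing Implicit Defensive.

Export Order.TTheory GRing.Theory Num.Theory.
Export numFieldNormedType.Exports.

#[global] Open Scope classical_set_scope.
#[global] Open Scope ring_scope.

(* Countable sets are modelled by countType, which includes finite ones. *)
Record wgraph (R : realType) (X : countType) := WGraph {
  wt : X -> X -> R;
  kill : X -> R;
  wt_ge0 : forall x y, 0 <= wt x y;
  wt_sym : forall x y, wt x y = wt y x;
  wt_diag : forall x, wt x x = 0;
  wt_sum : forall x, (\esum_(y in [set: X]) (wt x y)%:E < +oo)%E;
  kill_ge0 : forall x, 0 <= kill x
}.

(* Unordered sum of a real family, as the difference of the sums of its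
   positive and negative parts.  It is the intended value both for nonnegative
   families (possibly +oo) and for absolutely summable ones. *)
Definition xsum (R : realType) (X : countType) (f : X -> R) : \bar R :=
  (\esum_(y in [set: X]) (f^\+ y)%:E - \esum_(y in [set: X]) (f^\- y)%:E)%E.

Section Graph.
Variables (R : realType) (X : countType) (g : wgraph R X).
Local Notation b := (wt g).
Local Notation c := (kill g).

(* For x = y the one-point path (p empty) is allowed. *)
Definition graph_connected : Prop :=
  forall x y, exists2 p : seq X,
    path (fun u v => 0 < b u v) x p & last x p = y.

Definition calF : set (X -> R) :=
  [set f | forall x, (\esum_(y in [set: X]) (b x y * `|f y|)%:E < +oo)%E].

(* Meaningful for f in calF. *)
Definition laplacian (f : X -> R) (x : X) : R :=
  fine (xsum (fun y => b x y * (f x - f y))) + c x * f x.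

Definition energy (f : X -> R) : \bar R :=
  (2^-1%:E *
     (\esum_(p in [set: X * X]) (b p.1 p.2 * (f p.1 - f p.2) ^+ 2)%:E)
   + \esum_(x in [set: X]) (c x * f x ^+ 2)%:E)%E.

Definition calD : set (X -> R) := [set f | (energy f < +oo)%E].

Definition energy_norm (o : X) (f : X -> R) : R :=
  Num.sqrt (fine (energy f) + `|f o| ^+ 2).

Definition calD0 (o : X) : set (X -> R) :=
  [set f | calD f /\
     forall e : R, 0 < e ->
       exists phi : X -> R, [/\ finite_set [set x | phi x != 0], calD phi &
         energy_norm o (fun x => f x - phi x) < e]].

Definition green_function_at (o y : X) : set (X -> R) :=
  [set u | calD0 o u /\ laplacian u = (fun x => (x == y)%:R)].

Definition transient (o : X) : Prop :=
  forall y, exists! u : X -> R, green_function_at o y u.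

(* The default value is irrelevant for transient graphs. *)
Definition green (o : X) (x y : X) : R :=
  xget (fun=> 0) (green_function_at o y) x.

Definition green_op (o : X) (k : X -> R) (x : X) : \bar R :=
  xsum (fun y => green o x y * k y).

Definition calG (o : X) : set (X -> R) :=
  [set k | forall x,
     (\esum_(y in [set: X]) (green o x y * `|k y|)%:E < +oo)%E].

Definition potentials (o : X) : set (X -> R) :=
  [set u | calF u /\
     exists2 k, calG o k & forall x, (u x)%:E = green_op o k x].

Definition bdeg (K : {fset X}) (x : K) : R :=
  fine (\esum_(y in ~` [set` K]) (b (val x) y)%:E).

Definition dirichlet_op (K : {fset X}) (f : K -> R) (x : K) : R :=
  \sum_(y : K) b (val x) (val y) * (f x - f y)
  + (c (val x) + bdeg x) * f x.

(* Inverse of dirichlet_op K, the default value being irrelevant when the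
   latter is injective. *)
Definition dirichlet_green (K : {fset X}) : (K -> R) -> K -> R :=
  'pinv_(fun=> fun=> 0) [set: K -> R] (@dirichlet_op K).

(* (G_K d_K)(x), extended by 0 to x outside K. *)
Definition green_bdeg (K : {fset X}) (x : X) : R :=
  if insub x is Some u then dirichlet_green (@bdeg K) u else 0.

(* The walk lives on option X, with None as cemetery state. *)
Definition deg (x : X) : R := fine (\esum_(y in [set: X]) (b x y)%:E) + c x.

Definition walk_trans (s t : option X) : R :=
  match s, t with
  | Some x, Some y => b x y / deg x
  | Some x, None => c x / deg x
  | None, Some _ => 0
  | None, None => 1
  end.

(* Y is, under P, the walk started at x: its finite-dimensional distributions
   are those of the Markov chain with kernel walk_trans and initial state x. *)
Definition random_walk (d : measure_display) (Omega : measurableType d)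
    (P : probability Omega R) (Y : nat -> Omega -> option X) (x : X) : Prop :=
  (forall n (A : set (option X)), measurable (Y n @^-1` A)) /\
  (forall n (s : nat -> option X),
     P [set w | forall i, (i <= n)%N -> Y i w = s i] =
     ((s 0%N == Some x)%:R * \prod_(i < n) walk_trans (s i) (s i.+1))%:E).

End Graph.

Definition exhaustion (X : countType) (K : nat -> {fset X}) : Prop :=
  (forall n, (K n `<=` K n.+1)%fset) /\ (forall x, exists n, x \in K n).

(* inf of {n | Y_n = None}, equal to +oo when the walk never leaves X. *)
Definition exit_time (R : realType) (X : countType) (Omega : Type)
    (Y : nat -> Omega -> option X) (w : Omega) : \bar R :=
  ereal_inf [set (n%:R)%:E | n in [set n | Y n w = None]].

(* Main.v *)
Require Import Defs.
From mathcomp Require Import ring lra.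

(** Since L_K 1 = c + d_K, one has G_K d_K = 1 - G_K c for every finite K.  The
    function u = G_y lies in D_0 and satisfies L u = 1_y, so the function
    G_K 1_y - phi, for phi supported in K, has the same energy pairing as
    u - phi with every function supported in K; by Cauchy-Schwarz its energy
    is at most that of u - phi.  The same inequality against G_x bounds point
    values on K by the energy.  Letting phi tend to u gives G_K 1_y -> u
    pointwise along any exhaustion, hence G_K d_K -> 1 - Gc.  This limit is
    nonnegative and harmonic, so by connectedness it vanishes everywhere as
    soon as it vanishes somewhere.  It is also the probability that the walk
    never leaves X: both are the largest harmonic function bounded by 1. *)

Set Implicit Arguments.
Unset Strict Implicit.
Unset Printing Implicit Defensive.

Lemma cvg_seq_sum (R : realType) (I : eqType) (r : seq I) (F : nat -> I -> R)
    (l : I -> R) : {in r, forall x, F n x @[n --> \oo] --> l x} ->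
  \sum_(x <- r) F n x @[n --> \oo] --> \sum_(x <- r) l x.
Proof.
elim: r => [|x r IH] Fl.
  under eq_fun do rewrite big_nil; rewrite big_nil; exact: cvg_cst.
under eq_fun do rewrite big_cons; rewrite big_cons.
apply: cvgD; first by apply: Fl; rewrite mem_head.
by apply: IH => y yr; apply: Fl; rewrite in_cons yr orbT.
Qed.

(** * Unordered sums along exhaustions *)

Section Summation.
Variables (R : realType) (T : countType).
Implicit Types (a : T -> R) (M N : {fset T}) (K : nat -> {fset T}).

Lemma seq_sum_le_esum (I : choiceType) (a : I -> R) (s : R) (r : seq I) :
  uniq r -> (forall y, 0 <= a y) ->
  (\esum_(y in [set: I]) (a y)%:E <= s%:E)%E -> \sum_(y <- r) a y <= s.
Proof.
move=> r_uniq a0 les; rewrite -lee_fin; apply: le_trans les.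
apply: ereal_sup_ge; exists (\sum_(y <- r) (a y)%:E)%E; last by rewrite sumEFin.
by exists [set` r]; [split|rewrite -fsbig_seq].
Qed.

Lemma fset_sum_le_esum a (s : R) M : (forall y, 0 <= a y) ->
  (\esum_(y in [set: T]) (a y)%:E <= s%:E)%E -> \sum_(y <- M) a y <= s.
Proof. by apply: seq_sum_le_esum; exact: fset_uniq. Qed.

Lemma esum_le_fset_sum a (s : \bar R) :
  (forall M, (\sum_(y <- M) a y)%:E <= s)%E ->
  (\esum_(y in [set: T]) (a y)%:E <= s)%E.
Proof.
move=> les; apply: ub_ereal_sup => _ [F [Ffin _] <-].
by rewrite fsbig_finite// sumEFin.
Qed.

Lemma ler_fset_sum a M N : (forall y, 0 <= a y) -> (M `<=` N)%fset ->
  \sum_(y <- M) a y <= \sum_(y <- N) a y.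
Proof.
move=> a0 MN; have -> : M = [fset y in N | y \in M]%fset.
  by apply/fsetP => y; rewrite !inE andb_idl// => /(fsubsetP MN).
rewrite [leRHS](big_fsetID _ (mem M)) /= lerDl.
by apply: sumr_ge0.
Qed.

Lemma exhaustion_le K m n : exhaustion K -> (m <= n)%N -> (K m `<=` K n)%fset.
Proof.
move=> [Kmono _] /subnKC <-; elim: (n - m)%N => [|k IH]; first by rewrite addn0.
by rewrite addnS; exact: fsubset_trans IH (Kmono _).
Qed.

Lemma exhaustion_near K M : exhaustion K -> \forall n \near \oo, (M `<=` K n)%fset.
Proof.
move=> Kex; elim/fset1U_rect: M => [|x M xM IH].
  by near=> n; exact: fsub0set.
have [m xm] := Kex.2 x.
near=> n; rewrite fsubUset fsub1set; apply/andP; split; last by near: n.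
suff mn : (m <= n)%N by exact: (fsubsetP (exhaustion_le Kex mn)).
by near: n; exact: nbhs_infty_ge.
Unshelve. all: by end_near. Qed.

Lemma exhaustion_near_in K x : exhaustion K -> \forall n \near \oo, x \in K n.
Proof.
move=> Kex; have := exhaustion_near [fset x]%fset Kex.
by apply: filterS => n; rewrite fsub1set.
Qed.

Lemma exhaustion_exists : exists K : nat -> {fset T}, exhaustion K.
Proof.
(* [K_n] collects the elements decoded from the numbers below [n], so [x] has entered at the index
   one past its code. *)
exists (fun n => [fset x in pmap choice.unpickle (iota 0 n)]%fset); split.
  move=> n; apply/fsubsetP => x; rewrite !inE -addn1 iotaD pmap_cat mem_cat.
  by move=> ->.
move=> x; exists (choice.pickle x).+1; rewrite !inE mem_pmap.
by apply/mapP; exists (choice.pickle x); rewrite ?choice.pickleK// mem_iota/= add0n ltnS.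
Qed.

Lemma fset_sum_approx a (s e : R) : 0 < e ->
  \esum_(y in [set: T]) (a y)%:E = s%:E -> exists M, s - e <= \sum_(y <- M) a y.
Proof.
move=> e0 es; apply/not_existsP => sM.
have: (\esum_(y in [set: T]) (a y)%:E <= (s - e)%:E)%E.
  apply: esum_le_fset_sum => M; rewrite lee_fin.
  by have /negP := sM M; rewrite -ltNge => /ltW.
by rewrite es lee_fin; lra.
Qed.

(** A finite set whose sum is within [e] of [s] is eventually contained in [K n], and no finite sum
    exceeds [s]. *)
Lemma cvg_fset_sum K a (s : R) : exhaustion K -> (forall y, 0 <= a y) ->
  \esum_(y in [set: T]) (a y)%:E = s%:E ->
  (\sum_(y <- K n) a y) @[n --> \oo] --> s.
Proof.
move=> Kex a0 es; apply/cvgrPdist_le => e e0.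
have [M sM] := fset_sum_approx e0 es.
near=> n.
have MK : (M `<=` K n)%fset by near: n; exact: exhaustion_near.
have lo := ler_fset_sum a0 MK.
have hi : \sum_(y <- K n) a y <= s by apply: fset_sum_le_esum; rewrite ?es.
by rewrite ler_norml; lra.
Unshelve. all: by end_near. Qed.

(** The limit bounds every finite sum, so the unordered sum is finite; uniqueness of limits then
    gives its value. *)
Lemma esum_cvg_fset_sum K a (s : R) : exhaustion K -> (forall y, 0 <= a y) ->
  (\sum_(y <- K n) a y) @[n --> \oo] --> s ->
  \esum_(y in [set: T]) (a y)%:E = s%:E.
Proof.
move=> Kex a0 cs.
have es : (\esum_(y in [set: T]) (a y)%:E <= s%:E)%E.
  apply: esum_le_fset_sum => M; rewrite lee_fin.
  apply: (ler_cvg_to (cvg_cst _) cs); near=> n; apply: ler_fset_sum => //.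
  by near: n; exact: exhaustion_near.
have fs : \esum_(y in [set: T]) (a y)%:E \is a fin_num.
  rewrite ge0_fin_numE ?(le_lt_trans es) ?ltry//.
  by apply: esum_ge0 => y _; rewrite lee_fin.
have /esym es' := fineK fs; rewrite es'; congr _%:E.
apply/esym; apply: (cvg_unique (@norm_hausdorff _ _) cs).
exact: cvg_fset_sum Kex a0 es'.
Unshelve. all: by end_near. Qed.

Lemma xsum_ge0 a : (forall y, 0 <= a y) ->
  xsum a = \esum_(y in [set: T]) (a y)%:E.
Proof.
move=> a0; rewrite /xsum [X in (_ - X)%E]esum1 ?sube0; last first.
  by move=> y _; rewrite /funrneg max_r// oppr_le0.
by apply: eq_esum => y _; rewrite /funrpos max_l.
Qed.

(** Both parts of [a] are dominated by its absolute value, so [xsum] is a difference of two finite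
    sums and each part converges separately. *)
Lemma cvg_fset_sum_xsum K a : exhaustion K ->
  (\esum_(y in [set: T]) (`|a y|)%:E < +oo)%E ->
  (\sum_(y <- K n) a y) @[n --> \oo] --> fine (xsum a).
Proof.
move=> Kex afin.
have fin f : (forall y, 0 <= f y <= `|a y|) ->
    \esum_(y in [set: T]) (f y)%:E \is a fin_num.
  move=> fa; rewrite ge0_fin_numE; last first.
    by apply: esum_ge0 => y _; rewrite lee_fin; case/andP: (fa y).
  apply: le_lt_trans afin; apply: le_esum => y _.
  by rewrite lee_fin; case/andP: (fa y).
have absE y : a^\+ y + a^\- y = `|a y| by exact: (congr1 (@^~ y) (funrposDneg a)).
have fp : \esum_(y in [set: T]) (a^\+ y)%:E \is a fin_num.
  by apply: fin => y; rewrite funrpos_ge0 -absE lerDl funrneg_ge0.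
have fn : \esum_(y in [set: T]) (a^\- y)%:E \is a fin_num.
  by apply: fin => y; rewrite funrneg_ge0 -absE lerDr funrpos_ge0.
rewrite /xsum fineB//.
rewrite (_ : (fun n => _) = (fun n => \sum_(y <- K n) a^\+ y - \sum_(y <- K n) a^\- y)).
  by apply: cvgB; apply: cvg_fset_sum => //; rewrite ?fineK.
apply/funext => n; rewrite -sumrB; apply: eq_bigr => y _.
by rewrite -[in LHS](funrposBneg a).
Qed.

End Summation.

(** For [C > 0] the quadratic is evaluated at its minimiser; for [C <= 0] it would take a negative
    value unless [S = C = 0]. *)
Lemma discriminant_le0 (R : realFieldType) (A S C : R) :
  (forall t, 0 <= A - 2 * t * S + t ^+ 2 * C) -> S ^+ 2 <= C * A.
Proof.
move=> quad.
have A0 : 0 <= A by have := quad 0; nra.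
have [C0|C0] := ltP 0 C.
  have := quad (S / C).
  have -> : A - 2 * (S / C) * S + (S / C) ^+ 2 * C = (C * A - S ^+ 2) / C.
    by field; rewrite gt_eqF.
  by rewrite pmulr_lge0 ?invr_gt0 ?subr_ge0.
have S0 : S = 0.
  apply/eqP; apply: contraT => S_neq0.
  (* This [t] makes the linear term [-(A + 1)], so the quadratic would be at most -1. *)
  have := quad ((A + 1) / (2 * S)).
  have -> : A - 2 * ((A + 1) / (2 * S)) * S = - 1 by field.
  have : 0 <= ((A + 1) / (2 * S)) ^+ 2 by exact: sqr_ge0.
  by nra.
suff /eqP -> : C == 0 by rewrite S0; nra.
apply: contraT => C_neq0.
have {C_neq0}C0 : C < 0 by rewrite lt_neqAle C_neq0.
(* With [q = (A + 1) / (- C)], the added 1 ensures [t ^+ 2 >= q], hence [t ^+ 2 * C <= -(A + 1)]. *)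
have := quad ((A + 1) / (- C) + 1).
have q0 : 0 <= (A + 1) / (- C) by rewrite divr_ge0; lra.
have qC : (A + 1) / (- C) * C = - (A + 1) by field; rewrite lt_eqF.
rewrite S0 mulr0 subr0; set q := (A + 1) / (- C) in q0 qC *.
have : (q + 1) ^+ 2 * C <= q * C by nra.
by lra.
Qed.

(** * Energy on finite subsets *)

Section FiniteForms.
Variables (R : realType) (X : countType) (g : wgraph R X).
Local Notation b := (wt g).
Local Notation c := (kill g).
Local Notation deg := (deg g).
Implicit Types (f h psi : X -> R) (x y : X) (K M : {fset X}).

(* For [f] supported in [K] this is L f; on [K] it is L_K applied to the
   restriction of [f]. *)
Definition dir_lap K f x : R := deg x * f x - \sum_(y <- K) b x y * f y.

(* The Laplacian of the subgraph induced by [M]. *)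
Definition sub_lap M f x : R := \sum_(y <- M) b x y * (f x - f y) + c x * f x.

(** By [sub_energyE] this is the energy restricted to the edges and vertices inside [M]. *)
Definition sub_energy M f : R := \sum_(x <- M) f x * sub_lap M f x.

Lemma esum_wt x : \esum_(y in [set: X]) (b x y)%:E = (deg x - c x)%:E.
Proof.
rewrite /Defs.deg addrK fineK// ge0_fin_numE ?wt_sum//.
by apply: esum_ge0 => y _; rewrite lee_fin wt_ge0.
Qed.

Lemma sum_wt_le K x : \sum_(y <- K) b x y <= deg x - c x.
Proof.
by apply: fset_sum_le_esum => [y|]; [exact: wt_ge0|rewrite esum_wt].
Qed.

Lemma deg_ge0 x : 0 <= deg x.
Proof.
rewrite addr_ge0 ?kill_ge0//; apply: fine_ge0.
by apply: esum_ge0 => y _; rewrite lee_fin wt_ge0.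
Qed.

Lemma cvg_sum_wt (K : nat -> {fset X}) x : exhaustion K ->
  \sum_(y <- K n) b x y @[n --> \oo] --> deg x - c x.
Proof. by move=> Kex; apply: cvg_fset_sum => //; [exact: wt_ge0|exact: esum_wt]. Qed.

Lemma sub_lapE M f x :
  sub_lap M f x = (\sum_(y <- M) b x y + c x) * f x - \sum_(y <- M) b x y * f y.
Proof.
rewrite /sub_lap mulrDl mulr_suml addrAC -sumrB; congr (_ + _).
by apply: eq_bigr => y _; rewrite mulrBr.
Qed.

Lemma sub_lapB M f h x :
  sub_lap M (fun y => f y - h y) x = sub_lap M f x - sub_lap M h x.
Proof.
rewrite /sub_lap opprD addrACA -sumrB -mulrBr; congr (_ + _).
by apply: eq_bigr => y _; ring.
Qed.

Lemma sub_lapZ M t f x : sub_lap M (fun y => t * f y) x = t * sub_lap M f x.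
Proof.
rewrite /sub_lap mulrDr mulr_sumr; congr (_ + _); last by ring.
by apply: eq_bigr => y _; ring.
Qed.

(** Green's formula. By symmetry of [b], the sum [S] equals its copy with [x] and [y] exchanged;
    adding the two copies produces the difference of [h]. *)
Lemma green_finite M f h : \sum_(x <- M) h x * sub_lap M f x =
  2^-1 * (\sum_(x <- M) \sum_(y <- M) b x y * ((f x - f y) * (h x - h y)))
  + \sum_(x <- M) c x * (f x * h x).
Proof.
pose S := \sum_(x <- M) \sum_(y <- M) b x y * ((f x - f y) * h x).
have S2 : \sum_(x <- M) \sum_(y <- M) b x y * ((f x - f y) * (h x - h y)) = S + S.
  have S' : S = \sum_(x <- M) \sum_(y <- M) b x y * ((f y - f x) * h y).
    by rewrite /S exchange_big; do 2!apply: eq_bigr => ? _; rewrite wt_sym.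
  rewrite {2}S' -big_split; apply: eq_bigr => x _ /=.
  by rewrite -big_split; apply: eq_bigr => y _ /=; ring.
rewrite S2 (_ : 2^-1 * (S + S) = S); last by field.
rewrite -big_split; apply: eq_bigr => x _ /=.
rewrite /sub_lap mulrDr mulr_sumr; congr (_ + _); last by ring.
by apply: eq_bigr => y _; ring.
Qed.

Lemma sub_energyE M f : sub_energy M f =
  2^-1 * (\sum_(x <- M) \sum_(y <- M) b x y * (f x - f y) ^+ 2)
  + \sum_(x <- M) c x * f x ^+ 2.
Proof. by rewrite /sub_energy green_finite. Qed.

Lemma sub_energy_ge0 M f : 0 <= sub_energy M f.
Proof.
rewrite sub_energyE addr_ge0 ?mulr_ge0 ?invr_ge0//.
  by apply: sumr_ge0 => x _; apply: sumr_ge0 => y _; rewrite mulr_ge0 ?wt_ge0 ?sqr_ge0.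
by apply: sumr_ge0 => x _; rewrite mulr_ge0 ?kill_ge0 ?sqr_ge0.
Qed.

Lemma sub_energyBZ M f psi t : sub_energy M (fun x => f x - t * psi x) =
  sub_energy M f - 2 * t * (\sum_(x <- M) psi x * sub_lap M f x)
  + t ^+ 2 * sub_energy M psi.
Proof.
have sym : \sum_(x <- M) psi x * sub_lap M f x = \sum_(x <- M) f x * sub_lap M psi x.
  rewrite !green_finite; congr (_ * _ + _); apply: eq_bigr => x _; last by rewrite (mulrC (f x)).
  by apply: eq_bigr => y _; rewrite (mulrC (f x - f y)).
have -> S : 2 * t * S = t * S + t * S by ring.
rewrite {2}sym /sub_energy !mulr_sumr.
rewrite -big_split -sumrB -big_split; apply: eq_bigr => x _ /=.
by rewrite sub_lapB sub_lapZ; ring.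
Qed.

(** Both sums are nonnegative, so finiteness of the energy makes each of them a real number. *)
Lemma calDP f : calD g f <-> exists s1 s2,
  [/\ \esum_(p in [set: X * X]) (b p.1 p.2 * (f p.1 - f p.2) ^+ 2)%:E = s1%:E,
      \esum_(x in [set: X]) (c x * f x ^+ 2)%:E = s2%:E &
      energy g f = (2^-1 * s1 + s2)%:E].
Proof.
rewrite /calD /energy /=; split=> [|[s1 [s2 [-> -> _]]]]; last by rewrite ltry.
have e1 : (0 <= \esum_(p in [set: X * X]) (b p.1 p.2 * (f p.1 - f p.2) ^+ 2)%:E)%E.
  by apply: esum_ge0 => p _; rewrite lee_fin mulr_ge0 ?wt_ge0 ?sqr_ge0.
have e2 : (0 <= \esum_(x in [set: X]) (c x * f x ^+ 2)%:E)%E.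
  by apply: esum_ge0 => p _; rewrite lee_fin mulr_ge0 ?kill_ge0 ?sqr_ge0.
case: (esum _ _) e1 => [r1| |] //= _; case: (esum _ _) e2 => [r2| |] //= _.
- by move=> _; exists r1, r2.
- by rewrite gt0_muley ?lte_fin ?invr_gt0.
- by rewrite gt0_muley ?lte_fin ?invr_gt0.
Qed.

Lemma sub_energy_le M f : calD g f -> sub_energy M f <= fine (energy g f).
Proof.
move=> /calDP[s1 [s2 [e1 e2 ->]]]; rewrite sub_energyE /=.
apply: lerD; last first.
  by apply: fset_sum_le_esum => [x|]; rewrite ?e2// mulr_ge0 ?kill_ge0 ?sqr_ge0.
rewrite ler_pM2l ?invr_gt0//.
have -> : \sum_(x <- M) \sum_(y <- M) b x y * (f x - f y) ^+ 2 =
    \sum_(p <- [seq (x, y) | x <- M, y <- M]) b p.1 p.2 * (f p.1 - f p.2) ^+ 2.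
  by rewrite big_allpairs.
apply: seq_sum_le_esum => [|p|]; rewrite ?e1//; last first.
  by rewrite mulr_ge0 ?wt_ge0 ?sqr_ge0.
by apply: allpairs_uniq; rewrite ?fset_uniq// => -[? ?] [? ?].
Qed.

Lemma energy_ge0 f : 0 <= fine (energy g f).
Proof.
apply: fine_ge0; apply: adde_ge0.
  rewrite mule_ge0 ?lee_fin ?invr_ge0//.
  by apply: esum_ge0 => p _; rewrite lee_fin mulr_ge0 ?wt_ge0 ?sqr_ge0.
by apply: esum_ge0 => p _; rewrite lee_fin mulr_ge0 ?kill_ge0 ?sqr_ge0.
Qed.

(** From [(u - v)^2 <= 2 u^2 + 2 v^2]; [fin] states it for a general weighted sum so that it serves
    both the edge part and the killing part. *)
Lemma calDB f h : calD g f -> calD g h -> calD g (fun x => f x - h x).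
Proof.
have fin (I : choiceType) (w u v t : I -> R) (s s' : R) : (forall i, 0 <= w i) ->
    (forall i, t i = u i - v i) ->
    \esum_(i in [set: I]) (w i * u i ^+ 2)%:E = s%:E ->
    \esum_(i in [set: I]) (w i * v i ^+ 2)%:E = s'%:E ->
    exists s'', \esum_(i in [set: I]) (w i * t i ^+ 2)%:E = s''%:E.
  move=> w0 tE es es'.
  have w2 i q : (0 <= (w i * q ^+ 2)%:E)%E by rewrite lee_fin mulr_ge0 ?sqr_ge0.
  exists (fine (\esum_(i in [set: I]) (w i * t i ^+ 2)%:E)).
  rewrite fineK// ge0_fin_numE ?esum_ge0//.
  apply: (@le_lt_trans _ _ (\esum_(i in [set: I])
      (((w i * u i ^+ 2)%:E + (w i * u i ^+ 2)%:E) +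
       ((w i * v i ^+ 2)%:E + (w i * v i ^+ 2)%:E)))%E).
    apply: le_esum => i _; rewrite -!EFinD lee_fin tE.
    by have := w0 i; have := sqr_ge0 (u i + v i); nra.
  by rewrite !esumD ?es ?es' -?EFinD ?ltry// => i _; rewrite ?adde_ge0.
move=> /calDP[s1 [s2 [e1 e2 _]]] /calDP[s3 [s4 [e3 e4 _]]].
have [||s5 e5] := fin _ _ _ _ (fun p => (f p.1 - h p.1) - (f p.2 - h p.2)) _ _ _ _ e1 e3.
- by move=> p; exact: wt_ge0.
- by move=> p; ring.
have [||s6 e6] := fin _ _ _ _ (fun x => f x - h x) _ _ _ _ e2 e4 => //.
  exact: kill_ge0.
by rewrite /calD /energy /= e5 e6 ltry.
Qed.

(** For [psi] supported in [K] the two forms differ only in the diagonal coefficient, which for [M]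
    is a partial row sum plus [c] and hence at most [deg]. *)
Lemma sub_energy_le_dir_lap K M psi : (K `<=` M)%fset ->
  (forall x, x \notin K -> psi x = 0) ->
  sub_energy M psi <= \sum_(x <- K) psi x * dir_lap K psi x.
Proof.
move=> KM psi0; rewrite /sub_energy -(big_fset_incl _ KM); last first.
  by move=> x _ xK; rewrite psi0// mul0r.
apply: ler_sum => x _; rewrite sub_lapE /dir_lap.
rewrite -[X in _ * (_ - X)](big_fset_incl _ KM); last by move=> y _ yK; rewrite psi0// mulr0.
rewrite mulrBr [leRHS]mulrBr lerD2r mulrCA [leRHS]mulrCA -expr2.
by rewrite ler_wpM2r ?sqr_ge0// -lerBrDr sum_wt_le.
Qed.

(** Expanding the nonnegative energy of [f - t * psi] on [M n], bounding the two square terms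
    independently of [n] and passing to the limit yields a quadratic in [t] that is nowhere
    negative. *)
Lemma energy_cauchy_schwarz (M : nat -> {fset X}) K psi f l :
  exhaustion M -> calD g f -> (forall x, x \notin K -> psi x = 0) ->
  (forall x, x \in K -> sub_lap (M n) f x @[n --> \oo] --> l x) ->
  (\sum_(x <- K) psi x * l x) ^+ 2 <=
  (\sum_(x <- K) psi x * dir_lap K psi x) * fine (energy g f).
Proof.
move=> Mex fD psi0 fl; apply: discriminant_le0 => t.
set C := \sum_(x <- K) _ * dir_lap _ _ _.
have cvgS : \sum_(x <- K) psi x * sub_lap (M n) f x @[n --> \oo] -->
    \sum_(x <- K) psi x * l x.
  by apply: cvg_seq_sum => x xK; apply: cvgM; [exact: cvg_cst|exact: fl].
have cvgA : fine (energy g f) - 2 * t * \sum_(x <- K) psi x * sub_lap (M n) f x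
     + t ^+ 2 * C @[n --> \oo] -->
     fine (energy g f) - 2 * t * \sum_(x <- K) psi x * l x + t ^+ 2 * C.
  by apply: cvgD; [apply: cvgB; [exact: cvg_cst|apply: cvgM => //; exact: cvg_cst]|exact: cvg_cst].
apply: (ler_cvg_to (cvg_cst _) cvgA); near=> n.
have KM : (K `<=` M n)%fset by near: n; exact: exhaustion_near.
apply: le_trans (sub_energy_ge0 (M n) (fun x => f x - t * psi x)) _.
rewrite sub_energyBZ.
have <- : \sum_(x <- K) psi x * sub_lap (M n) f x =
    \sum_(x <- M n) psi x * sub_lap (M n) f x.
  by apply: big_fset_incl KM _ => x _ xK; rewrite psi0// mul0r.
rewrite !lerD ?ler_wpM2l ?sqr_ge0 ?sub_energy_le//.
exact: sub_energy_le_dir_lap.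
Unshelve. all: by end_near. Qed.

End FiniteForms.

(** * The Dirichlet problem on finite subsets *)

Section Transient.
Variables (R : realType) (X : countType) (g : wgraph R X) (o : X).
Hypothesis g_transient : transient g o.
Local Notation b := (wt g).
Local Notation c := (kill g).
Local Notation deg := (deg g).
Local Notation G := (green g o).
Implicit Types (f h psi k v w : X -> R) (x y : X) (K M : {fset X}).

(** The differences are absolutely summable against [b x], because [|t| <= 1 + t^2] and both the row
    sum and the energy are finite. *)
Lemma cvg_sub_lap (M : nat -> {fset X}) f x : exhaustion M -> calD g f ->
  sub_lap g (M n) f x @[n --> \oo] --> laplacian g f x.
Proof.
move=> Mex /calDP[s1 [s2 [e1 _ _]]].
apply: cvgD; last exact: cvg_cst.
apply: cvg_fset_sum_xsum => //.
apply: (@le_lt_trans _ _ (deg x - c x + s1)%:E); last by rewrite ltry.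
apply: esum_le_fset_sum => N; rewrite lee_fin.
apply: (@le_trans _ _ (\sum_(y <- N) b x y + \sum_(y <- N) b x y * (f x - f y) ^+ 2)).
  rewrite -big_split; apply: ler_sum => y _ /=.
  have := wt_ge0 g x y; rewrite normrM => b0; rewrite ger0_norm//.
  rewrite -{2}(mulr1 (b x y)) -mulrDr ler_wpM2l//.
  by rewrite -[in leRHS]real_normK ?num_real//; nra.
apply: lerD; first exact: sum_wt_le.
have -> : \sum_(y <- N) b x y * (f x - f y) ^+ 2 =
    \sum_(p <- [seq (x, y) | y <- N]) b p.1 p.2 * (f p.1 - f p.2) ^+ 2.
  by rewrite big_map.
apply: seq_sum_le_esum => [|p|]; rewrite ?e1//.
  by rewrite map_inj_uniq ?fset_uniq// => ? ? [].
by rewrite mulr_ge0 ?wt_ge0 ?sqr_ge0.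
Qed.

Lemma greenP y : calD0 g o (G ^~ y) /\ laplacian g (G ^~ y) = (fun x => (x == y)%:R).
Proof.
have [u [uG _]] := g_transient y.
exact: (@xgetPex _ (fun=> 0) (green_function_at g o y) (ex_intro _ u uG)).
Qed.

Lemma green_calD y : calD g (G ^~ y).
Proof. by have [[]] := greenP y. Qed.

Lemma cvg_sub_lap_green (M : nat -> {fset X}) x y : exhaustion M ->
  sub_lap g (M n) (G ^~ y) x @[n --> \oo] --> ((x == y)%:R : R).
Proof.
by move=> Mex; have := @cvg_sub_lap _ _ x Mex (green_calD y); rewrite (greenP y).2.
Qed.

(** Pairing [psi] with the Laplacian of [G ^~ x], which is the indicator of [x], returns [psi x];
    the Cauchy-Schwarz inequality for the energy applies. *)
Lemma sqr_le_dirichlet_form K psi x : (forall x, x \notin K -> psi x = 0) ->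
  psi x ^+ 2 <=
  (\sum_(z <- K) psi z * dir_lap g K psi z) * fine (energy g (G ^~ x)).
Proof.
move=> psi0; have [M Mex] := exhaustion_exists X.
have -> : psi x = \sum_(z <- K) psi z * (z == x)%:R.
  have [xK|xK] := boolP (x \in K).
    rewrite (big_fsetD1 x)//= eqxx mulr1 big_seq big1 ?addr0// => z.
    by rewrite !inE => /andP[/negPf ->]; rewrite mulr0.
  rewrite psi0// big_seq big1// => z zK.
  by case: eqP zK => [->|_ _]; [rewrite (negPf xK)|rewrite mulr0].
apply: (energy_cauchy_schwarz Mex (green_calD x) psi0) => z _.
exact: cvg_sub_lap_green.
Qed.

(** Definiteness of the Dirichlet form; comparison, injectivity and invertibility on [K] all derive
    from it. *)
Lemma dirichlet_form_le0_eq0 K psi : (forall x, x \notin K -> psi x = 0) ->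
  \sum_(z <- K) psi z * dir_lap g K psi z <= 0 -> forall x, psi x = 0.
Proof.
move=> psi0 le0 x; apply/eqP; rewrite -sqrf_eq0 eq_le sqr_ge0 andbT.
apply: le_trans (sqr_le_dirichlet_form x psi0) _.
by rewrite mulr_le0_ge0// energy_ge0.
Qed.

(* The negative part of [w] has nonpositive Dirichlet form. *)
Lemma maximum_principle K w : (forall x, x \in K -> 0 <= dir_lap g K w x) ->
  forall x, x \in K -> 0 <= w x.
Proof.
move=> Lw0 x xK.
pose psi z := if z \in K then Num.max (- w z) 0 else 0.
suff : psi x = 0 by rewrite /psi xK; case: (lerP (- w x) 0); lra.
apply: (@dirichlet_form_le0_eq0 K) => [z /negPf zK|]; first by rewrite /psi zK.
rewrite big_seq; apply: sumr_le0 => z zK.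
have psi_ge0 y : 0 <= psi y.
  by rewrite /psi; case: ifP => // _; rewrite le_max lexx orbT.
have wpsi y : y \in K -> 0 <= w y + psi y.
  by move=> yK; rewrite /psi yK; case: (lerP (- w y) 0); lra.
have wpsi0 : psi z * (w z + psi z) = 0.
  by rewrite /psi zK; case: (lerP (- w z) 0) => _; ring.
(* Here [psi = (w + psi) - w]. After multiplication by [psi z] the diagonal term vanishes, since
   [psi * (w + psi) = 0], and the two remaining terms are nonpositive. *)
have -> : dir_lap g K psi z =
    deg z * (w z + psi z) - \sum_(y <- K) b z y * (w y + psi y) - dir_lap g K w z.
  rewrite (eq_bigr (fun y => b z y * w y + b z y * psi y)).
    by rewrite big_split /dir_lap /=; ring.
  by move=> y _; ring.
have S0 : 0 <= \sum_(y <- K) b z y * (w y + psi y).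
  by rewrite big_seq; apply: sumr_ge0 => y yK; rewrite mulr_ge0 ?wt_ge0 ?wpsi.
have := mulr_ge0 (psi_ge0 z) (Lw0 z zK); have := mulr_ge0 (psi_ge0 z) S0.
move: (\sum_(_ <- _) _) (dir_lap _ _ _ _) => S L psiS psiL.
have -> : psi z * (deg z * (w z + psi z) - S - L) =
  deg z * (psi z * (w z + psi z)) - psi z * S - psi z * L by ring.
by rewrite wpsi0; lra.
Qed.

Lemma dir_lapB K f h x :
  dir_lap g K (fun y => f y - h y) x = dir_lap g K f x - dir_lap g K h x.
Proof.
rewrite /(dir_lap _ _ (fun y => _)) (eq_bigr (fun y => b x y * f y - b x y * h y)).
  by rewrite sumrB /dir_lap; ring.
by move=> y _; ring.
Qed.

Lemma dir_lap_le K f h :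
  (forall x, x \in K -> dir_lap g K f x <= dir_lap g K h x) ->
  forall x, x \in K -> f x <= h x.
Proof.
move=> fh x xK; rewrite -subr_ge0.
apply: (@maximum_principle K (fun y => h y - f y)) => // z zK.
by rewrite dir_lapB subr_ge0 fh.
Qed.

Lemma dir_lap_inj K f h :
  (forall x, x \in K -> dir_lap g K f x = dir_lap g K h x) ->
  forall x, x \in K -> f x = h x.
Proof.
move=> fh x xK; apply/eqP; rewrite eq_le.
by apply/andP; split; apply: (@dir_lap_le K) => // z zK; rewrite fh.
Qed.

(** The operator acts on a finite-dimensional space, so its injectivity makes its matrix
    invertible. *)
Lemma dir_lap_surj K k : exists v, (forall x, x \notin K -> v x = 0) /\
  (forall x, x \in K -> dir_lap g K v x = k x).
Proof.
(* The column index is the point of evaluation, since functions on [K] are encoded as row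
   vectors. *)
pose A : 'M[R]_#|{: K}| := \matrix_(i, j)
  (deg (val (enum_val j)) *+ (i == j) - b (val (enum_val j)) (val (enum_val i))).
pose ext (u : 'rV[R]_#|{: K}|) x := if insub x is Some y then u 0 (enum_rank y) else 0.
have extE u (y : K) : ext u (val y) = u 0 (enum_rank y) by rewrite /ext valK.
have ext0 u x : x \notin K -> ext u x = 0 by move=> xK; rewrite /ext insubN.
have extA u (y : K) : dir_lap g K (ext u) (val y) = (u *m A) 0 (enum_rank y).
  rewrite mxE (eq_bigr (fun i => u 0 i * (deg (val y) *+ (i == enum_rank y)) -
      b (val y) (val (enum_val i)) * u 0 i)); last first.
    by move=> i _; rewrite mxE enum_rankK mulrBr (mulrC (b _ _)).
  rewrite sumrB /dir_lap extE; congr (_ - _).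
    rewrite (bigD1 (enum_rank y))//= eqxx big1 ?addr0 1?mulrC// => i /negPf ->.
    by rewrite mulr0.
  rewrite big_seq_fsetE (reindex (fun i : 'I_#|{: K}| => enum_val i)) /=.
    2: by apply: onW_bij; exact: enum_val_bij.
  by apply: eq_bigr => i _; rewrite extE enum_valK.
have Aunit : A \in unitmx.
  rewrite -row_free_unit; apply: inj_row_free => u uA.
  apply/rowP => i; rewrite mxE -(enum_valK i) -extE.
  apply: (@dir_lap_inj K _ (fun=> 0)) => [x xK|]; last exact: valP.
  rewrite -[x]/(val [` xK]%fset) extA uA mxE /dir_lap mulr0 big1 ?subrr// => y _.
  by rewrite mulr0.
exists (ext ((\row_i k (val (enum_val i))) *m invmx A)); split=> x xK; first exact: ext0.
by rewrite -[x]/(val [` xK]%fset) extA mulmxKV// mxE enum_rankK.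
Qed.

(** This is [G_K k] extended by 0 to all of [X]. The default value is never taken, by
    [dir_lap_surj]. *)
Definition dir_sol K k : X -> R := xget (fun=> 0)
  [set v | (forall x, x \notin K -> v x = 0) /\
           (forall x, x \in K -> dir_lap g K v x = k x)].

Lemma dir_solP K k : (forall x, x \notin K -> dir_sol K k x = 0) /\
  (forall x, x \in K -> dir_lap g K (dir_sol K k) x = k x).
Proof. exact: (xgetPex (fun=> 0) (dir_lap_surj K k)). Qed.

Lemma dir_sol_out K k x : x \notin K -> dir_sol K k x = 0.
Proof. exact: (dir_solP K k).1. Qed.

Lemma dir_lap_sol K k x : x \in K -> dir_lap g K (dir_sol K k) x = k x.
Proof. exact: (dir_solP K k).2. Qed.

Lemma dir_sol_ge0 K k x : (forall y, 0 <= k y) -> 0 <= dir_sol K k x.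
Proof.
move=> k0; have [xK|xK] := boolP (x \in K); last by rewrite dir_sol_out.
by apply: (@maximum_principle K) => // z zK; rewrite dir_lap_sol.
Qed.

Lemma bdegE K (u : K) :
  bdeg g u = deg (val u) - c (val u) - \sum_(y <- K) b (val u) y.
Proof.
have b0 y : [set: X] y -> (0 <= (b (val u) y)%:E)%E by rewrite lee_fin wt_ge0.
have := esum_wt g (val u); rewrite (esumID [set` K])// !setTI /bdeg.
rewrite esum_fset//; last by move=> y _; exact: b0.
rewrite -fsbig_seq ?fset_uniq// sumEFin => e; rewrite -[deg _ - _]/(fine (_%:E)) -e.
case: (\esum_(_ in ~` _) _)%E e => [r| |] //= _; first by ring.
Qed.

(** The boundary degree completes the row sum over [K], so the diagonal coefficient of [L_K] is the
    full degree. *)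
Lemma dirichlet_opE K f (u : K) :
  dirichlet_op g (fun v : K => f (val v)) u = dir_lap g K f (val u).
Proof.
rewrite /dirichlet_op -(big_seq_fsetE _ _ predT (fun y => b (val u) y * (f (val u) - f y))) /=.
rewrite bdegE (eq_bigr (fun y => b (val u) y * f (val u) - b (val u) y * f y)).
  by rewrite sumrB -mulr_suml /dir_lap; ring.
by move=> y _; rewrite mulrBr.
Qed.

Lemma dirichlet_op_inj K : injective (@dirichlet_op R X g K).
Proof.
move=> u v uv; pose ext (w : K -> R) x := if insub x is Some y then w y else 0.
have extE (w : K -> R) : w = fun z => ext w (val z) by apply/funext => z; rewrite /ext valK.
rewrite (extE u) (extE v) in uv *.
apply/funext => y; apply: (@dir_lap_inj K) => [x xK|]; last exact: valP.
by have /(congr1 (@^~ [` xK]%fset)) := uv; rewrite !dirichlet_opE.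
Qed.

Lemma green_bdegE K x : x \in K -> green_bdeg g K x = 1 - dir_sol K c x.
Proof.
move=> xK; rewrite /green_bdeg insubT /dirichlet_green.
(* Once [d_K] is exhibited as [L_K (1 - G_K c)], injectivity lets the inverse cancel [L_K]. *)
have -> : @bdeg R X g K = dirichlet_op g (fun u : K => 1 - dir_sol K c (val u)).
  apply/funext => u; rewrite bdegE (dirichlet_opE (fun x => 1 - dir_sol K c x)).
  rewrite (dir_lapB _ (fun=> 1)) dir_lap_sol; last exact: valP.
  rewrite /dir_lap.
  have -> : \sum_(y <- K) b (val u) y * 1 = \sum_(y <- K) b (val u) y.
    by apply: eq_bigr => y _; rewrite mulr1.
  by ring.
rewrite pinvKV ?inE// => ? ? _ _; exact: dirichlet_op_inj.
Qed.

End Transient.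

(** * Finite approximation of the Green function *)

Section GreenLimit.
Variables (R : realType) (X : countType) (g : wgraph R X) (o : X).
Hypotheses (g_connected : graph_connected g) (g_transient : transient g o).
Local Notation b := (wt g).
Local Notation c := (kill g).
Local Notation deg := (deg g).
Local Notation G := (green g o).
Implicit Types (f h psi k v w : X -> R) (x y : X) (K M : {fset X}).

Lemma energy_norm_ge0 f : 0 <= energy_norm g o f.
Proof. exact: sqrtr_ge0. Qed.

Lemma sqr_energy_norm f : energy_norm g o f ^+ 2 = fine (energy g f) + f o ^+ 2.
Proof.
by rewrite sqr_sqrtr ?real_normK ?num_real// addr_ge0 ?energy_ge0 ?sqr_ge0.
Qed.

Lemma energy_le_norm f : fine (energy g f) <= energy_norm g o f ^+ 2.
Proof. by rewrite sqr_energy_norm lerDl sqr_ge0. Qed.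

Lemma wt_energy_le f x y : calD g f ->
  b x y * (f x - f y) ^+ 2 <= 2 * fine (energy g f).
Proof.
move=> /calDP[s1 [s2 [e1 e2 ->]]] /=.
have s2_ge0 : 0 <= s2.
  by rewrite -lee_fin -e2 esum_ge0// => z _; rewrite lee_fin mulr_ge0 ?kill_ge0 ?sqr_ge0.
suff : \sum_(p <- [:: (x, y)]) b p.1 p.2 * (f p.1 - f p.2) ^+ 2 <= s1.
  by rewrite big_seq1 /=; lra.
apply: seq_sum_le_esum => [//|p|]; last by rewrite e1.
by rewrite mulr_ge0 ?wt_ge0 ?sqr_ge0.
Qed.

(* Chaining [wt_energy_le] along a path from [o] to [x]. *)
Lemma pointwise_le_energy_norm x : exists2 C : R, 0 <= C &
  forall f, calD g f -> `|f x| <= C * energy_norm g o f.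
Proof.
have [p] := g_connected o x.
have : exists2 C : R, 0 <= C & forall f, calD g f -> `|f o| <= C * energy_norm g o f.
  exists 1 => // f _; rewrite mul1r -ler_sqr ?nnegrE ?energy_norm_ge0//.
  by rewrite sqr_energy_norm real_normK ?num_real// lerDr energy_ge0.
move: {1 3 4}o; elim: p => [|z p IH] u [C C0 fC] /=; first by move=> _ <-; exists C.
move=> /andP[buz zp]; apply: IH zp.
exists (C + Num.sqrt (2 / b u z)); first by rewrite addr_ge0 ?sqrtr_ge0.
move=> f fD; rewrite -(subrK (f u) (f z)) mulrDl addrC.
apply: le_trans (ler_normD _ _) _; rewrite lerD ?fC//.
rewrite -ler_sqr ?nnegrE ?mulr_ge0 ?sqrtr_ge0//.
rewrite exprMn sqr_sqrtr ?divr_ge0 ?(ltW buz)// real_normK ?num_real//.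
apply: (@le_trans _ _ (2 / b u z * fine (energy g f))).
  rewrite mulrAC ler_pdivlMr// mulrC -sqrrN opprB; exact: wt_energy_le.
by rewrite ler_wpM2l ?divr_ge0 ?(ltW buz)// energy_le_norm.
Qed.

(** The off-diagonal sum is constant once [M n] contains [K], while the diagonal coefficient
    increases to [deg x]. *)
Lemma cvg_sub_lap_supp (M : nat -> {fset X}) K f x : exhaustion M ->
  (forall x, x \notin K -> f x = 0) ->
  sub_lap g (M n) f x @[n --> \oo] --> dir_lap g K f x.
Proof.
move=> Mex f0; under eq_fun do rewrite sub_lapE.
have -> : dir_lap g K f x = (deg x - c x + c x) * f x - \sum_(y <- K) b x y * f y.
  by rewrite subrK.
apply: cvgB.
  apply: cvgM; last exact: cvg_cst.
  by apply: cvgD; [exact: cvg_sum_wt|exact: cvg_cst].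
apply: cvg_near_cst; near=> n.
have KM : (K `<=` M n)%fset by near: n; exact: exhaustion_near.
by apply/esym/(big_fset_incl _ KM) => y _ yK; rewrite f0// mulr0.
Unshelve. all: by end_near. Qed.

(* [dir_sol K (1_y)] is the Q-projection of [G ^~ y] onto the functions
   supported in [K], so it is at least as close to [phi] as [G ^~ y] is. *)
Lemma dir_sol_dist K (phi : X -> R) x y : calD g phi ->
  (forall x, x \notin K -> phi x = 0) ->
  (dir_sol g K (fun z => (z == y)%:R) x - phi x) ^+ 2 <=
  fine (energy g (fun z => G z y - phi z)) * fine (energy g (G ^~ x)).
Proof.
move=> phiD phi0; set u := dir_sol _ _ _.
have [M Mex] := exhaustion_exists X.
pose psi z := u z - phi z.
have psi0 z : z \notin K -> psi z = 0.
  by move=> zK; rewrite /psi /u (dir_sol_out g_transient)// phi0// subrr.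
set Q := fine (energy g (fun z => _)).
set S := \sum_(z <- K) psi z * dir_lap g K psi z.
(* On [K] both [dir_lap g K u] and the Laplacian of [G ^~ y] are the indicator of [y], so [psi]
   paired with the Laplacian of [G ^~ y - phi] is again [S]. *)
have SQ : S ^+ 2 <= S * Q.
  apply: (energy_cauchy_schwarz Mex _ psi0) => [|z zK].
    by apply: calDB => //; exact: green_calD.
  rewrite dir_lapB (dir_lap_sol g_transient)//.
  rewrite (_ : (fun n => _) =
    (fun n => sub_lap g (M n) (G ^~ y) z - sub_lap g (M n) phi z)).
    by apply: cvgB; [exact: cvg_sub_lap_green|exact: cvg_sub_lap_supp].
  by apply/funext => n; rewrite sub_lapB.
have {SQ}SQ : S <= Q.
  have [S0|S0] := ltP 0 S; first by rewrite -(ler_pM2l S0) -expr2.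
  by apply: le_trans S0 _; exact: energy_ge0.
apply: le_trans (sqr_le_dirichlet_form g_transient x psi0) _.
by rewrite ler_wpM2r ?energy_ge0.
Qed.

Lemma cvg_dir_sol_delta (K : nat -> {fset X}) x y : exhaustion K ->
  dir_sol g (K n) (fun z => (z == y)%:R) x @[n --> \oo] --> G x y.
Proof.
move=> Kex; apply/cvgrPdist_le => e e0.
have [C C0 fC] := pointwise_le_energy_norm x.
set B := Num.sqrt (fine (energy g (G ^~ x))).
have B0 : 0 <= B by exact: sqrtr_ge0.
(* The total error will be at most [(C + B) * d], with [C] from the distance of [G ^~ y] to [phi]
   and [B] from that of [dir_sol] to [phi]; the 1 keeps the denominator positive. *)
have d0 : 0 < e / (C + B + 1) by rewrite divr_gt0//; lra.
have [[_ approx] _] := greenP g_transient y.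
have [phi [phi_fin phiD]] := approx _ d0.
set f := (fun z => _); set d := _ / _ => /ltW fd.
have fD : calD g f by apply: calDB => //; exact: green_calD.
near=> n.
have phi0 z : z \notin K n -> phi z = 0.
  apply: contraNeq => phi_neq0; suff sK : (fset_set [set x | phi x != 0%R] `<=` K n)%fset.
    by apply: (fsubsetP sK); rewrite in_fset_set// inE.
  by near: n; exact: exhaustion_near.
have h1 : `|dir_sol g (K n) (fun z => (z == y)%:R) x - phi x| <= d * B.
  rewrite -ler_sqr ?nnegrE ?normr_ge0 ?(mulr_ge0 (ltW d0) B0)// real_normK ?num_real//.
  apply: le_trans (dir_sol_dist x y phiD phi0) _.
  rewrite exprMn sqr_sqrtr ?energy_ge0// ler_wpM2r ?energy_ge0//.
  apply: le_trans (energy_le_norm _) _.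
  by rewrite ler_sqr ?nnegrE ?energy_norm_ge0 ?(ltW d0).
have h2 : `|G x y - phi x| <= C * d.
  by apply: le_trans (fC _ fD) _; rewrite ler_wpM2l.
have h3 : (C + B) * d <= e.
  by rewrite /d mulrA ler_pdivrMr; nra.
by move: h1 h2; rewrite !ler_norml; lra.
Unshelve. all: by end_near. Qed.

Lemma green_ge0 x y : 0 <= G x y.
Proof.
have [K Kex] := exhaustion_exists X.
apply: (ler_cvg_to (cvg_cst _) (@cvg_dir_sol_delta _ x y Kex)).
by near=> n; apply: (dir_sol_ge0 g_transient) => // z; exact: ler0n.
Unshelve. all: by end_near. Qed.

(** As [G] is nonnegative, passing from [sub_lap] on [M n] to [dir_lap] on [K] raises the diagonal
    term and shrinks the subtracted sum; the values on [M n] tend to the indicator. *)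
Lemma dir_lap_green_ge K x y : (x == y)%:R <= dir_lap g K (G ^~ y) x.
Proof.
have [M Mex] := exhaustion_exists X.
apply: (ler_cvg_to (cvg_sub_lap_green g_transient (x := x) (y := y) Mex) (cvg_cst _)).
near=> n.
have KM : (K `<=` M n)%fset by near: n; exact: exhaustion_near.
rewrite sub_lapE /dir_lap lerB//.
  by rewrite ler_wpM2r ?green_ge0// -lerBrDr sum_wt_le.
by apply: ler_fset_sum => // z; rewrite mulr_ge0 ?wt_ge0 ?green_ge0.
Unshelve. all: by end_near. Qed.

Lemma dir_sol_delta_le K x y : dir_sol g K (fun z => (z == y)%:R) x <= G x y.
Proof.
have [xK|xK] := boolP (x \in K); last by rewrite (dir_sol_out g_transient)// green_ge0.
apply: (@dir_lap_le _ _ _ _ g_transient K _ (G ^~ y)) xK => z zK.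
by rewrite (dir_lap_sol g_transient)// dir_lap_green_ge.
Qed.

(** Both sides solve the same Dirichlet problem on [K], which makes [dir_sol] of indicators the
    kernel of [G_K]. *)
Lemma dir_solE K k x :
  dir_sol g K k x = \sum_(y <- K) dir_sol g K (fun z => (z == y)%:R) x * k y.
Proof.
have [xK|xK] := boolP (x \in K); last first.
  rewrite (dir_sol_out g_transient)// big1// => y _.
  by rewrite (dir_sol_out g_transient)// mul0r.
apply: (@dir_lap_inj _ _ _ _ g_transient K _
  (fun x => \sum_(y <- K) dir_sol g K (fun z => (z == y)%:R) x * k y)) xK => z zK.
rewrite (dir_lap_sol g_transient)// /dir_lap mulr_sumr.
under [X in _ - X]eq_bigr do rewrite mulr_sumr.
rewrite exchange_big -sumrB /= (eq_bigr (fun y => (z == y)%:R * k y)).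
  rewrite (big_fsetD1 z)//= eqxx mul1r big_seq big1 ?addr0// => y.
  by rewrite !inE eq_sym => /andP[/negPf ->]; rewrite mul0r.
move=> y _; rewrite -(dir_lap_sol g_transient (fun z => (z == y)%:R) zK).
rewrite /dir_lap mulrBl mulrA mulr_suml; congr (_ - _).
by apply: eq_bigr => t _; rewrite mulrA.
Qed.

(** A Fatou argument: over a finite [F] the sum is a limit of sums bounded by [dir_sol] as soon as
    [K n] contains [F]. *)
Lemma esum_green_le (K : nat -> {fset X}) k x (s : R) : exhaustion K ->
  (forall y, 0 <= k y) -> (\forall n \near \oo, dir_sol g (K n) k x <= s) ->
  (\esum_(y in [set: X]) (G x y * k y)%:E <= s%:E)%E.
Proof.
move=> Kex k0 ks; apply: esum_le_fset_sum => F; rewrite lee_fin.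
have cvgF : \sum_(y <- F) dir_sol g (K n) (fun z => (z == y)%:R) x * k y
    @[n --> \oo] --> \sum_(y <- F) G x y * k y.
  apply: cvg_seq_sum => y _; apply: cvgM; last exact: cvg_cst.
  exact: cvg_dir_sol_delta.
apply: (ler_cvg_to cvgF (cvg_cst _)); near=> n.
have FK : (F `<=` K n)%fset by near: n; exact: exhaustion_near.
apply: (@le_trans _ _ (dir_sol g (K n) k x)); last by near: n.
rewrite dir_solE; apply: ler_fset_sum => // y.
by rewrite mulr_ge0// (dir_sol_ge0 g_transient)// => z; exact: ler0n.
Unshelve. all: by end_near. Qed.

Lemma dir_sol_le_esum K k x (s : R) : (forall y, 0 <= k y) ->
  \esum_(y in [set: X]) (G x y * k y)%:E = s%:E -> dir_sol g K k x <= s.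
Proof.
move=> k0 es; apply: (@le_trans _ _ (\sum_(y <- K) G x y * k y)).
  by rewrite dir_solE; apply: ler_sum => y _; rewrite ler_wpM2r ?dir_sol_delta_le.
by apply: fset_sum_le_esum => [y|]; rewrite ?es// mulr_ge0 ?green_ge0.
Qed.

(** The value [s] is an upper bound throughout. Below, a finite [F] carries all of [s] but [e / 2],
    and convergence of the kernels on [F] costs another [e / 2]. *)
Lemma cvg_dir_sol (K : nat -> {fset X}) k x (s : R) : exhaustion K ->
  (forall y, 0 <= k y) -> \esum_(y in [set: X]) (G x y * k y)%:E = s%:E ->
  dir_sol g (K n) k x @[n --> \oo] --> s.
Proof.
move=> Kex k0 es; apply/cvgrPdist_le => e e0.
have e20 : 0 < e / 2 by lra.
have [F sF] := fset_sum_approx e20 es.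
have cvgF : \sum_(y <- F) dir_sol g (K n) (fun z => (z == y)%:R) x * k y
    @[n --> \oo] --> \sum_(y <- F) G x y * k y.
  apply: cvg_seq_sum => y _; apply: cvgM; last exact: cvg_cst.
  exact: cvg_dir_sol_delta.
near=> n.
have FK : (F `<=` K n)%fset by near: n; exact: exhaustion_near.
have lo1 : `|\sum_(y <- F) G x y * k y -
    \sum_(y <- F) dir_sol g (K n) (fun z => (z == y)%:R) x * k y| <= e / 2.
  by near: n; move/cvgrPdist_le: cvgF; exact.
have lo2 : \sum_(y <- F) dir_sol g (K n) (fun z => (z == y)%:R) x * k y <=
    dir_sol g (K n) k x.
  rewrite dir_solE; apply: ler_fset_sum => // y.
  by rewrite mulr_ge0// (dir_sol_ge0 g_transient)// => z; exact: ler0n.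
have := dir_sol_le_esum (K n) k0 es; move: lo1; rewrite !ler_norml.
by lra.
Unshelve. all: by end_near. Qed.

End GreenLimit.

(** * Potentials *)

Section Potentials.
Variables (R : realType) (X : countType) (g : wgraph R X) (o : X).
Hypotheses (g_connected : graph_connected g) (g_transient : transient g o).
Local Notation b := (wt g).
Local Notation c := (kill g).
Local Notation deg := (deg g).
Local Notation G := (green g o).
Implicit Types (A f h psi k v w : X -> R) (x y : X).

(** This is [L (G k) = k], obtained as the limit of [dir_lap] applied to [dir_sol]. A Fatou argument
    gives one inequality, the bound of [dir_sol] by [A] the other. *)
Lemma esum_wt_green k A x : (forall y, 0 <= k y) ->
  (forall x, \esum_(y in [set: X]) (G x y * k y)%:E = (A x)%:E) ->
  \esum_(y in [set: X]) (b x y * A y)%:E = (deg x * A x - k x)%:E.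
Proof.
move=> k0 GA; have [K Kex] := exhaustion_exists X.
have cvgA z : dir_sol g (K n) k z @[n --> \oo] --> A z.
  exact: (cvg_dir_sol g_connected g_transient Kex k0 (GA z)).
have A0 z : 0 <= A z.
  rewrite -lee_fin -GA esum_ge0// => y _.
  by rewrite lee_fin mulr_ge0 ?(green_ge0 g_connected g_transient).
have cvgLHS : deg x * dir_sol g (K n) k x - k x @[n --> \oo] --> deg x * A x - k x.
  by apply: cvgB; [apply: cvgM => //; exact: cvg_cst|exact: cvg_cst].
have eqn : \forall n \near \oo, deg x * dir_sol g (K n) k x - k x =
    \sum_(y <- K n) b x y * dir_sol g (K n) k y.
  near=> n; have xK : x \in K n by near: n; exact: exhaustion_near_in.
  by rewrite -(dir_lap_sol g_transient k xK) /dir_lap; ring.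
have le : (\esum_(y in [set: X]) (b x y * A y)%:E <= (deg x * A x - k x)%:E)%E.
  apply: esum_le_fset_sum => F; rewrite lee_fin.
  have cvgF : \sum_(y <- F) b x y * dir_sol g (K n) k y @[n --> \oo] -->
      \sum_(y <- F) b x y * A y.
    by apply: cvg_seq_sum => y _; apply: cvgM => //; exact: cvg_cst.
  apply: (ler_cvg_to cvgF cvgLHS); near=> n.
  have FK : (F `<=` K n)%fset by near: n; exact: exhaustion_near.
  have -> : deg x * dir_sol g (K n) k x - k x =
    \sum_(y <- K n) b x y * dir_sol g (K n) k y by near: n.
  apply: ler_fset_sum => // y.
  by rewrite mulr_ge0 ?wt_ge0// (dir_sol_ge0 g_transient).
apply/eqP; rewrite eq_le le /=.
have fin : \esum_(y in [set: X]) (b x y * A y)%:E \is a fin_num.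
  rewrite ge0_fin_numE ?(le_lt_trans le) ?ltry//.
  by apply: esum_ge0 => y _; rewrite lee_fin mulr_ge0 ?wt_ge0.
rewrite -(fineK fin) lee_fin; apply: (ler_cvg_to cvgLHS (cvg_cst _)).
near=> n; have -> : deg x * dir_sol g (K n) k x - k x =
    \sum_(y <- K n) b x y * dir_sol g (K n) k y by near: n.
apply: (@le_trans _ _ (\sum_(y <- K n) b x y * A y)).
  apply: ler_sum => y _; rewrite ler_wpM2l ?wt_ge0//.
  exact: (dir_sol_le_esum g_connected g_transient _ k0 (GA y)).
by apply: fset_sum_le_esum => [y|]; rewrite ?fineK// mulr_ge0 ?wt_ge0.
Unshelve. all: by end_near. Qed.

(** [Gc] is at most 1 by [green_op_kill_le1], so [fine] loses no information. *)
Definition green_kill x : R := fine (green_op g o c x).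

Lemma green_opE k x : (forall y, 0 <= k y) ->
  green_op g o k x = \esum_(y in [set: X]) (G x y * k y)%:E.
Proof.
move=> k0; rewrite /green_op xsum_ge0// => y.
by rewrite mulr_ge0 ?(green_ge0 g_connected g_transient).
Qed.

(** Comparison with the constant 1, for which [L_K 1 = c + d_K >= c]. *)
Lemma dir_sol_kill_le1 (K : {fset X}) x : dir_sol g K c x <= 1.
Proof.
have [xK|xK] := boolP (x \in K); last by rewrite (dir_sol_out g_transient).
apply: (@dir_lap_le _ _ _ _ g_transient K _ (fun=> 1)) xK => z zK.
rewrite (dir_lap_sol g_transient)// /dir_lap mulr1 lerBrDr addrC -lerBrDr.
have -> : \sum_(y <- K) b z y * 1 = \sum_(y <- K) b z y.
  by apply: eq_bigr => y _; rewrite mulr1.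
exact: sum_wt_le.
Qed.

Lemma green_op_kill_le1 x : (green_op g o c x <= 1)%E.
Proof.
have [K Kex] := exhaustion_exists X.
rewrite (green_opE _ (kill_ge0 g)).
apply: (esum_green_le g_connected g_transient Kex); first exact: kill_ge0.
by near=> n; exact: dir_sol_kill_le1.
Unshelve. all: by end_near. Qed.

Lemma green_opE_kill x : green_op g o c x = (green_kill x)%:E.
Proof.
rewrite /green_kill fineK// ge0_fin_numE.
  exact: le_lt_trans (green_op_kill_le1 x) (ltry _).
rewrite (green_opE _ (kill_ge0 g)); apply: esum_ge0 => y _.
by rewrite lee_fin mulr_ge0 ?kill_ge0 ?(green_ge0 g_connected g_transient).
Qed.

Lemma green_op_kill_eq1 x : green_op g o c x = 1%E <-> green_kill x = 1.
Proof. by rewrite green_opE_kill; split=> [[]|->]. Qed.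

Lemma esum_green_kill x :
  \esum_(y in [set: X]) (G x y * c y)%:E = (green_kill x)%:E.
Proof. by rewrite -(green_opE _ (kill_ge0 g)) green_opE_kill. Qed.

Lemma green_kill_le1 x : green_kill x <= 1.
Proof. by rewrite -lee_fin -green_opE_kill green_op_kill_le1. Qed.

Lemma cvg_green_bdeg (K : nat -> {fset X}) x : exhaustion K ->
  green_bdeg g (K n) x @[n --> \oo] --> 1 - green_kill x.
Proof.
move=> Kex.
have cvg1 : 1 - dir_sol g (K n) c x @[n --> \oo] --> 1 - green_kill x.
  apply: cvgB; first exact: cvg_cst.
  exact: (cvg_dir_sol g_connected g_transient Kex (kill_ge0 g) (esum_green_kill x)).
apply: cvg_trans cvg1; apply: near_eq_cvg; near=> n.
rewrite (green_bdegE g_transient)//.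
by near: n; exact: exhaustion_near_in.
Unshelve. all: by end_near. Qed.

Lemma cvg_green_bdeg0 (K : nat -> {fset X}) x : exhaustion K ->
  (green_bdeg g (K n) x @[n --> \oo] --> (0 : R)) <-> green_kill x = 1.
Proof.
move=> Kex; have cvg1 := @cvg_green_bdeg _ x Kex; split=> [cvg0|h1].
  suff : 1 - green_kill x = 0 by lra.
  exact: (cvg_unique (@norm_hausdorff _ _) cvg1 cvg0).
by rewrite h1 subrr in cvg1.
Qed.

(** Harmonicity of [1 - Gc]: both [L 1] and [L (Gc)] equal [c]. *)
Lemma esum_wt_escape x :
  \esum_(y in [set: X]) (b x y * (1 - green_kill y))%:E =
  (deg x * (1 - green_kill x))%:E.
Proof.
have [K Kex] := exhaustion_exists X.
apply: (esum_cvg_fset_sum Kex) => [y|].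
  by rewrite mulr_ge0 ?wt_ge0// subr_ge0 green_kill_le1.
have -> : deg x * (1 - green_kill x) =
    (deg x - c x) - (deg x * green_kill x - c x) by ring.
rewrite (_ : (fun n => _) = (fun n => \sum_(y <- K n) b x y -
    \sum_(y <- K n) b x y * green_kill y)).
  apply: cvgB; first exact: cvg_sum_wt.
  apply: cvg_fset_sum => // [y|].
    rewrite mulr_ge0 ?wt_ge0// -lee_fin -esum_green_kill esum_ge0// => z _.
    by rewrite lee_fin mulr_ge0 ?kill_ge0 ?(green_ge0 g_connected g_transient).
  by apply: esum_wt_green => //; [exact: kill_ge0|exact: esum_green_kill].
apply/funext => n; rewrite -sumrB; apply: eq_bigr => y _; ring.
Qed.

(** Minimum principle: where the nonnegative harmonic function [1 - Gc] vanishes, it vanishes at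
    every neighbour too, and a path carries this to any vertex. *)
Lemma green_kill_eq1_all x : green_kill x = 1 -> forall y, green_kill y = 1.
Proof.
move=> hx y; have [p] := g_connected x y.
elim: p x hx => [|z p IH] x hx /=; first by move=> _ <-.
move=> /andP[bxz zp]; apply: IH zp; apply/eqP; rewrite eq_le green_kill_le1.
have : \sum_(t <- [:: z]) b x t * (1 - green_kill t) <= deg x * (1 - green_kill x).
  apply: seq_sum_le_esum => [//|t|]; last by rewrite esum_wt_escape.
  by rewrite mulr_ge0 ?wt_ge0// subr_ge0 green_kill_le1.
by rewrite big_seq1 hx subrr mulr0 pmulr_rle0// subr_le0.
Qed.

Lemma potential1_of_green_kill :
  (forall x, green_kill x = 1) -> potentials g o (fun=> 1).
Proof.
move=> h1; split=> [x|].
  apply: le_lt_trans (wt_sum g x); apply: le_esum => y _.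
  by rewrite lee_fin normr1 mulr1.
exists c => [x|x]; last by rewrite green_opE_kill h1.
apply: (@le_lt_trans _ _ (\esum_(y in [set: X]) (G x y * c y)%:E)); last first.
  by rewrite esum_green_kill ltry.
by apply: le_esum => y _; rewrite lee_fin ger0_norm ?kill_ge0.
Qed.

(** If [1 = G k], applying [L] gives [k = L 1 = c]. As [esum_wt_green] concerns nonnegative
    functions, it is used on the two parts of [k], with potentials [A] and [B]. *)
Lemma green_kill_of_potential1 :
  potentials g o (fun=> 1) -> forall x, green_kill x = 1.
Proof.
move=> [_ [k kG k1]].
have G0 := green_ge0 g_connected g_transient.
have fin f : (forall y, 0 <= f y <= `|k y|) -> exists A : X -> R,
    forall x, \esum_(y in [set: X]) (G x y * f y)%:E = (A x)%:E.
  move=> fk; exists (fun x => fine (\esum_(y in [set: X]) (G x y * f y)%:E)) => x.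
  rewrite fineK// ge0_fin_numE; last first.
    by apply: esum_ge0 => y _; case/andP: (fk y) => f0 _; rewrite lee_fin mulr_ge0.
  apply: le_lt_trans (kG x); apply: le_esum => y _.
  by case/andP: (fk y) => _ fk'; rewrite lee_fin ler_wpM2l.
have absE y : k^\+ y + k^\- y = `|k y| by exact: (congr1 (@^~ y) (funrposDneg k)).
have kE y : k^\+ y - k^\- y = k y by exact: (congr1 (@^~ y) (funrposBneg k)).
have p0 : forall y, 0 <= k^\+ y by exact: funrpos_ge0.
have n0 : forall y, 0 <= k^\- y by exact: funrneg_ge0.
have [y|A GA] := fin k^\+; first by rewrite p0 -absE lerDl n0.
have [y|B GB] := fin k^\-; first by rewrite n0 -absE lerDr p0.
have AB x : A x = 1 + B x.
  suff : (1 = A x - B x :> R) by lra.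
  apply: EFin_inj; apply: (etrans (k1 x)); rewrite /green_op /xsum EFinB -GA -GB.
  by congr (_ - _)%E; apply: eq_esum => y _;
    rewrite /funrpos /funrneg -?mulrN maxr_pMr// mulr0.
(* Applying [L] to [A = 1 + B] yields [k^\+ = c + k^\-]. *)
have kc x : k x = c x.
  have := esum_wt_green x p0 GA.
  under eq_esum do rewrite AB mulrDr mulr1 EFinD.
  have B0 y : 0 <= B y.
    by rewrite -lee_fin -GB esum_ge0// => z _; rewrite lee_fin mulr_ge0.
  rewrite esumD => [||y _]; last first.
  - by rewrite lee_fin mulr_ge0 ?wt_ge0.
  - by move=> y _; rewrite lee_fin wt_ge0.
  rewrite esum_wt (esum_wt_green x n0 GB) -EFinD AB => -[].
  by rewrite -kE; lra.
by move=> x; apply/green_op_kill_eq1; rewrite -(funext kc) -k1.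
Qed.

End Potentials.

(** * The random walk *)

Section Walk.
Variables (R : realType) (X : countType) (g : wgraph R X) (o : X).
Hypotheses (g_connected : graph_connected g) (g_transient : transient g o).
Local Notation b := (wt g).
Local Notation c := (kill g).
Local Notation deg := (deg g).
Implicit Types (x y : X) (s : nat -> X) (m n N : nat).

(** At a vertex of degree 0 the operator on the singleton would vanish, yet its value at [G ^~ x] is
    at least 1. *)
Lemma deg_gt0 x : 0 < deg x.
Proof.
rewrite lt_neqAle deg_ge0 andbT eq_sym; apply/eqP => deg0.
have := dir_lap_green_ge g_connected g_transient [fset x]%fset x x.
rewrite /dir_lap deg0 mul0r big_seq_fset1 wt_diag mul0r subrr eqxx.
by rewrite ler10.
Qed.

(* The probability that Y_1, ..., Y_N all lie in [X] for the walk started at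
   [x], by first-step analysis. *)
Fixpoint survival N x : R :=
  if N is N'.+1 then fine (\esum_(y in [set: X]) (b x y * survival N' y)%:E) / deg x
  else 1.

(** The bounds at stage [N] make the sum under [fine] finite, so bounds and recursion are proved
    together. *)
Lemma survival_step N : (forall x, 0 <= survival N x <= 1) ->
  forall x, 0 <= survival N.+1 x <= 1 /\
    \esum_(y in [set: X]) (b x y * survival N y)%:E = (deg x * survival N.+1 x)%:E.
Proof.
move=> h01 x /=; set S := esum _ _.
have S0 : (0 <= S)%E.
  apply: esum_ge0 => y _; rewrite lee_fin mulr_ge0 ?wt_ge0//.
  by case/andP: (h01 y).
have S1 : (S <= (deg x - c x)%:E)%E.
  rewrite -esum_wt; apply: le_esum => y _; rewrite lee_fin ler_piMr ?wt_ge0//.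
  by case/andP: (h01 y).
have Sfin : S \is a fin_num by rewrite ge0_fin_numE// (le_lt_trans S1) ?ltry.
move: S0 S1; rewrite -(fineK Sfin) !lee_fin /= => S0 S1; split; last first.
  by rewrite mulrC divfK ?gt_eqF ?deg_gt0.
rewrite divr_ge0 ?deg_ge0// ler_pdivrMr ?deg_gt0// mul1r.
by apply: le_trans S1 _; rewrite gerBl kill_ge0.
Qed.

Lemma survival_ge0_le1 N x : 0 <= survival N x <= 1.
Proof.
elim: N x => [|N IH] x; first by rewrite ler01 lexx.
exact: (survival_step IH x).1.
Qed.

Lemma survival_ge0 N x : 0 <= survival N x.
Proof. by case/andP: (survival_ge0_le1 N x). Qed.

Lemma survival_le1 N x : survival N x <= 1.
Proof. by case/andP: (survival_ge0_le1 N x). Qed.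

Lemma esum_survival N x : \esum_(y in [set: X]) (b x y * survival N y)%:E =
  (deg x * survival N.+1 x)%:E.
Proof. exact: (survival_step (survival_ge0_le1 N) x).2. Qed.

Lemma survival_noninc N x : survival N.+1 x <= survival N x.
Proof.
elim: N x => [|N IH] x; first exact: survival_le1.
rewrite -(ler_pM2l (deg_gt0 x)) -lee_fin -!esum_survival.
by apply: le_esum => y _; rewrite lee_fin ler_wpM2l ?wt_ge0.
Qed.

(** [1 - Gc] is harmonic and at most 1, and the recursion for [survival] preserves the order. *)
Lemma escape_le_survival N x : 1 - green_kill g o x <= survival N x.
Proof.
elim: N x => [|N IH] x /=.
  rewrite lerBlDr lerDl -lee_fin -(esum_green_kill g_connected g_transient).
  apply: esum_ge0 => y _.
  by rewrite lee_fin mulr_ge0 ?kill_ge0 ?(green_ge0 g_connected g_transient).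
rewrite -(ler_pM2l (deg_gt0 x)) -lee_fin -(esum_wt_escape g_connected g_transient).
rewrite -esum_survival.
by apply: le_esum => y _; rewrite lee_fin ler_wpM2l ?wt_ge0.
Qed.

(** The limit [q] is at least [1 - Gc]. Conversely [L_K (1 - q) >= c] on each finite [K], so [1 - q]
    dominates [G_K c] there and [Gc] in the limit. *)
Lemma cvg_survival x : survival N x @[N --> \oo] --> 1 - green_kill g o x.
Proof.
have noninc z : {homo survival ^~ z : n m / (n <= m)%N >-> m <= n}.
  by apply/nonincreasing_seqP => n; exact: survival_noninc.
have cvgS z : cvgn (survival ^~ z).
  apply: nonincreasing_is_cvgn => //.
  by exists 0 => _ [N _ <-]; exact: survival_ge0.
pose q z := limn (survival ^~ z).
suff -> : 1 - green_kill g o x = q x by exact: cvgS.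
apply/eqP; rewrite eq_le; apply/andP; split.
  apply: (ler_cvg_to (cvg_cst _) (cvgS x)).
  by near=> n; exact: escape_le_survival.
suff : green_kill g o x <= 1 - q x by lra.
have [K Kex] := exhaustion_exists X.
apply: (ler_cvg_to (cvg_dir_sol g_connected g_transient Kex (kill_ge0 g)
  (esum_green_kill g_connected g_transient x)) (cvg_cst _)).
near=> n; have xK : x \in K n by near: n; exact: exhaustion_near_in.
apply: (@dir_lap_le _ _ _ _ g_transient (K n) _ (fun z => 1 - q z)) xK => z zK.
rewrite (dir_lap_sol g_transient)//.
(* The index is shifted to [N.+1] in the diagonal term alone, which keeps the limit and makes the
   recursion applicable. *)
have cvg1 : deg z * (1 - survival N.+1 z) -
    \sum_(y <- K n) b z y * (1 - survival N y) @[N --> \oo] -->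
    dir_lap g (K n) (fun z => 1 - q z) z.
  apply: cvgB.
    apply: cvgM; first exact: cvg_cst.
    apply: cvgB; first exact: cvg_cst.
    by have := cvgS z; rewrite -(cvg_shiftS (survival ^~ z)).
  apply: cvg_seq_sum => y _; apply: cvgM; first exact: cvg_cst.
  by apply: cvgB; [exact: cvg_cst|exact: cvgS].
apply: (ler_cvg_to (cvg_cst _) cvg1); near=> N.
(* A second exhaustion evaluates the full sum over [X], of which the sum over [K n] is a part. *)
have [M Mex] := exhaustion_exists X.
have cvgW : \sum_(y <- M i) b z y * (1 - survival N y) @[i --> \oo] -->
    deg z - c z - deg z * survival N.+1 z.
  rewrite (_ : (fun i => _) = (fun i => \sum_(y <- M i) b z y -
      \sum_(y <- M i) b z y * survival N y)).
    apply: cvgB; first exact: cvg_sum_wt.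
    apply: cvg_fset_sum => // [y|]; last exact: esum_survival.
    by rewrite mulr_ge0 ?wt_ge0 ?survival_ge0.
  by apply/funext => i; rewrite -sumrB; apply: eq_bigr => y _; ring.
suff : \sum_(y <- K n) b z y * (1 - survival N y) <=
  deg z - c z - deg z * survival N.+1 z by lra.
apply: (ler_cvg_to (cvg_cst _) cvgW); near=> i.
apply: ler_fset_sum => [y|]; last by near: i; exact: exhaustion_near.
by rewrite mulr_ge0 ?wt_ge0// subr_ge0 survival_le1.
Unshelve. all: by end_near. Qed.

(** * Path events and survival probabilities *)

Variables (d : measure_display) (Omega : measurableType d).
Variables (P : probability Omega R) (Y : nat -> Omega -> option X) (x0 : X).
Hypothesis Y_walk : random_walk g P Y x0.

(** Recording the path up to time [m] allows induction on [N] from the finite-dimensional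
    distributions. One quantifier covers both conditions so that [measurable_path] applies. *)
Definition prefix_survive s m N : set Omega :=
  [set w | forall i, ((i <= m)%N -> Y i w = Some (s i)) /\
                     ((i <= m + N)%N -> Y i w <> None)].

Definition prefix_prob s m : R :=
  (s 0%N == x0)%:R * \prod_(i < m) (b (s i) (s i.+1) / deg (s i)).

Definition extend s m y : nat -> X := fun i => if (i <= m)%N then s i else y.

Lemma measurable_path (A : nat -> set (option X)) :
  measurable [set w | forall i, A i (Y i w)].
Proof.
rewrite (_ : [set w | _] = \bigcap_i (Y i @^-1` A i)).
  by apply: bigcapT_measurable => i; exact: (Y_walk.1).
by apply/seteqP; split=> w Aw i; [move=> _; exact: Aw|exact: Aw i I].
Qed.

Lemma measurable_prefix_survive s m N : measurable (prefix_survive s m N).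
Proof.
exact: (measurable_path (fun i t =>
  ((i <= m)%N -> t = Some (s i)) /\ ((i <= m + N)%N -> t <> None))).
Qed.

Lemma prefix_prob_extend s m y :
  prefix_prob (extend s m y) m.+1 = prefix_prob s m * (b (s m) y / deg (s m)).
Proof.
rewrite /prefix_prob big_ord_recr /= mulrA /extend leq0n leqnn ltnn; congr (_ * _ * _).
by apply: eq_bigr => i _; rewrite ltn_ord (ltnW (ltn_ord i)).
Qed.

Lemma prefix_surviveS s m N :
  prefix_survive s m N.+1 = \bigcup_y prefix_survive (extend s m y) m.+1 N.
Proof.
apply/seteqP; split=> [w sw|w [y _ sw] i].
  have := (sw m.+1).2; rewrite addnS ltnS leq_addr => /(_ isT).
  case Yw : (Y m.+1 w) => [y|] // _; exists y => // i; split.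
    rewrite /extend; case: ifP => [im _|im]; first exact: (sw i).1.
    by rewrite leq_eqVlt ltnS im orbF => /eqP ->.
  by rewrite addSnnS; exact: (sw i).2.
split=> [im|]; last by rewrite -addSnnS; exact: (sw i).2.
by rewrite (sw i).1 ?(leqW im)// /extend im.
Qed.

(** Induction on [N] takes the place of the Markov property: the base case is the law of a finite
    path, and the step splits the event by the position at time [m + 1]. *)
Lemma prefix_survive_prob s m N :
  P (prefix_survive s m N) = (prefix_prob s m * survival N (s m))%:E.
Proof.
elim: N s m => [|N IH] s m.
  rewrite mulr1 /prefix_prob.
  have := Y_walk.2 m (Some \o s) => /= <-; congr (P _).
  apply/seteqP; split=> w sw i; first by move=> /((sw i).1).
  by split=> [/sw//|]; rewrite addn0 => /sw ->.
have [K Kex] := exhaustion_exists X.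
pose F y := prefix_survive (extend s m y) m.+1 N.
have Fmeas y : measurable (F y) by exact: measurable_prefix_survive.
have Ftriv : trivIset [set: X] F.
  move=> y z _ _ [w [/(_ m.+1)[yw _] /(_ m.+1)[zw _]]].
  move: (yw (leqnn _)) (zw (leqnn _)); rewrite /extend ltnn => ->.
  by case.
(* Finite unions along an exhaustion turn countable additivity into a limit of finite sums, matched
   with the recursion for [survival]. *)
pose E n := \big[setU/set0]_(y <- K n) F y.
have EE n : E n = \bigcup_(y in [set` K n]) F y by rewrite /E -bigcup_fset.
have PE n : P (E n) = (\sum_(y <- K n)
    prefix_prob s m / deg (s m) * (b (s m) y * survival N y))%:E.
  rewrite measure_fbigsetU//; last exact: sub_trivIset Ftriv.
  rewrite -sumEFin; apply: eq_bigr => y _; apply: (etrans (IH _ _)).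
  rewrite prefix_prob_extend.
  by rewrite /extend ltnn; congr _%:E; ring.
have UE : prefix_survive s m N.+1 = \bigcup_n E n.
  rewrite prefix_surviveS; apply/seteqP; split=> w.
    move=> [y _ Fw]; have [n yn] := Kex.2 y.
    by exists n => //; rewrite EE; exists y.
  by move=> [n _]; rewrite EE => -[y _ Fw]; exists y.
have cvgP : P (E n) @[n --> \oo] --> P (prefix_survive s m N.+1).
  rewrite UE; apply: nondecreasing_cvg_mu => [n||n n' nn'].
  - by apply: bigsetU_measurable => y _; exact: Fmeas.
  - by rewrite -UE; exact: measurable_prefix_survive.
  - rewrite subsetEset !EE; apply: bigcup_subset => y /=.
    exact: (fsubsetP (exhaustion_le Kex nn')).
suff cvgS : P (E n) @[n --> \oo] --> (prefix_prob s m * survival N.+1 (s m))%:E.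
  exact: (cvg_unique (@ereal_hausdorff _) cvgP cvgS).
rewrite (funext PE); apply: cvg_EFin; first by near=> n.
have -> : prefix_prob s m * survival N.+1 (s m) =
    prefix_prob s m / deg (s m) * (deg (s m) * survival N.+1 (s m)).
  by rewrite mulrA divfK ?gt_eqF ?deg_gt0.
rewrite /comp /=; under eq_fun do rewrite -mulr_sumr.
apply: cvgM; first exact: cvg_cst.
apply: cvg_fset_sum => // [y|]; last exact: esum_survival.
by rewrite mulr_ge0 ?wt_ge0 ?survival_ge0.
Unshelve. all: by end_near. Qed.

Lemma prob_start : P [set w | Y 0%N w = Some x0] = 1%E.
Proof.
have := Y_walk.2 0%N (fun=> Some x0); rewrite eqxx big_ord0 mulr1 => <-.
congr (P _); apply/seteqP; split=> w /= Yw; last exact: Yw.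
by move=> i; rewrite leqn0 => /eqP ->.
Qed.

(** The survival event differs by a null set from its intersection with [Y 0 = Some x0], which is a
    [prefix_survive] event with [m = 0]. *)
Lemma prob_survive N :
  P [set w | forall i, (i <= N)%N -> Y i w <> None] = (survival N x0)%:E.
Proof.
set S := [set w | _]; set A := [set w | Y 0%N w = Some x0].
have mS : measurable S.
  exact: (measurable_path (fun i t => (i <= N)%N -> t <> None)).
have mA : measurable A by exact: (Y_walk.1 0%N [set Some x0]).
have PAC : P (~` A) = 0%E by rewrite probability_setC// prob_start subee.
have PA0 : P (S `\` A) = 0%E.
  apply: (@subset_measure0 _ _ _ P _ (~` A)).
  - exact: measurableD.
  - exact: measurableC.
  - by move=> w [].
  - exact: PAC.
have -> : P S = P (S `&` A).
  apply: (etrans (measureDI P mS mA)).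
  by apply: (etrans (congr1 (fun t => t + _)%E PA0)); exact: add0e.
have := prefix_survive_prob (fun=> x0) 0 N.
rewrite /prefix_prob eqxx big_ord0 !mul1r => <-; congr (P _).
apply/seteqP; split=> w.
  by move=> [Sw Aw] i; split=> [|iN]; [rewrite leqn0 => /eqP ->|exact: Sw].
by move=> sw; split=> [i iN|]; [exact: (sw i).2|exact: (sw 0%N).1].
Qed.

Lemma exit_time_finE w :
  (exit_time R Y w < +oo)%E <-> exists n, Y n w = None.
Proof.
split=> [/ereal_inf_lt[_ [n Yn _] _]|[n Yn]]; first by exists n.
by apply: le_lt_trans (ltry n%:R); apply: ereal_inf_lbound; exists n.
Qed.

(** The event is the complement of a decreasing intersection of survival events, so continuity from
    above and [cvg_survival] give its probability. *)
Lemma prob_exit_time_fin :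
  P [set w | (exit_time R Y w < +oo)%E] = (green_kill g o x0)%:E.
Proof.
pose S N := [set w | forall i, (i <= N)%N -> Y i w <> None].
have mS N : measurable (S N).
  exact: (measurable_path (fun i t => (i <= N)%N -> t <> None)).
have mcap : measurable (\bigcap_N S N) by exact: bigcapT_measurable.
have -> : [set w | (exit_time R Y w < +oo)%E] = ~` (\bigcap_N S N).
  apply/seteqP; split=> w /=.
    by move=> /exit_time_finE[n Yn] /(_ n I n (leqnn _)).
  move=> Sw; apply/exit_time_finE; apply: contrapT => noexit.
  by apply: Sw => N _ i _ Yi; apply: noexit; exists i.
rewrite probability_setC//.
have cvgP : (P \o S) N @[N --> \oo] --> P (\bigcap_N S N).
  apply: nonincreasing_cvg_mu => // [|n n' nn'].
    exact: le_lt_trans (probability_le1 P (mS 0%N)) (ltry _).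
  by rewrite subsetEset => w Sw i i_n; apply: Sw; exact: leq_trans nn'.
have -> : P (\bigcap_N S N) = (1 - green_kill g o x0)%:E.
  suff cvgS : (P \o S) N @[N --> \oo] --> (1 - green_kill g o x0)%:E.
    exact: (cvg_unique (@ereal_hausdorff _) cvgP cvgS).
  rewrite (_ : P \o S = EFin \o survival ^~ x0).
    by apply: cvg_EFin; [near=> n|exact: cvg_survival].
  by apply/funext => N; exact: prob_survive.
by rewrite -EFinB; congr _%:E; ring.
Unshelve. all: by end_near. Qed.

End Walk.

Theorem theorem5 (R : realType) (X : countType) (g : wgraph R X) (o : X)
    (d : measure_display) (Omega : measurableType d)
    (P : X -> probability Omega R) (Y : nat -> Omega -> option X)
    (g_connected : graph_connected g)
    (g_transient : transient g o)
    (Y_walk : forall x, random_walk g (P x) Y x) :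
  [<->
    (* (ii.a) *)
    exists x, green_op g o (kill g) x = 1%E;
    forall x, green_op g o (kill g) x = 1%E;
    potentials g o (fun=> 1);
    (* (ii.b) *)
    exists K, exhaustion K /\
      exists x, green_bdeg g (K n) x @[n --> \oo] --> (0 : R);
    exists K, exhaustion K /\
      forall x, green_bdeg g (K n) x @[n --> \oo] --> (0 : R);
    forall K, exhaustion K ->
      exists x, green_bdeg g (K n) x @[n --> \oo] --> (0 : R);
    forall K, exhaustion K ->
      forall x, green_bdeg g (K n) x @[n --> \oo] --> (0 : R);
    (* (ii.c) *)
    exists x, P x [set w | (exit_time R Y w < +oo)%E] = 1%E;
    forall x, P x [set w | (exit_time R Y w < +oo)%E] = 1%E
  ].
Proof.
have startP x := prob_exit_time_fin g_connected g_transient (Y_walk x).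
have op1 x := green_op_kill_eq1 g_connected g_transient x.
have bdeg1 K x := @cvg_green_bdeg0 _ _ _ _ g_connected g_transient K x.
have all1 := green_kill_eq1_all g_connected g_transient.
(* Each assertion becomes [green_kill = 1] at some or at all vertices, and [all1] passes from some
   to all. The vertex [o] and [exhaustion_exists] supply the witnesses. *)
tfae.
- by move=> [x /op1 hx] y; apply/op1; exact: (all1 x hx y).
- move=> h1; apply: (potential1_of_green_kill g_connected g_transient) => x.
  exact/op1.
- move=> /(green_kill_of_potential1 g_connected g_transient) h1.
  have [K Kex] := exhaustion_exists X.
  by exists K; split=> //; exists o; apply/bdeg1.
- move=> [K [Kex [x /(bdeg1 _ _ Kex) hx]]]; exists K; split=> // y.
  by apply/(bdeg1 _ _ Kex); exact: (all1 x hx y).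
- move=> [K [Kex /(_ o)/(bdeg1 _ _ Kex) ho]] M Mex.
  by exists o; apply/bdeg1.
- move=> h K Kex y; have [x /(bdeg1 _ _ Kex) hx] := h K Kex.
  by apply/(bdeg1 _ _ Kex); exact: (all1 x hx y).
- move=> h; have [K Kex] := exhaustion_exists X.
  by exists o; rewrite startP; congr _%:E; apply/(bdeg1 _ _ Kex); exact: h.
- move=> [x]; rewrite startP => -[hx] y.
  by rewrite startP (all1 _ hx y).
- move=> /(_ o); rewrite startP => -[ho].
  by exists o; apply/op1.
Qed.
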